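(* For each integer $N \ge 1$ let $X$ and $Y$ be independent random integers, each uniformly distributed on $\{1, \ldots, N\}$. Then, as $N \to \infty$, $$H(X, Y \mid X\cdot Y) = \Theta(\log\log N).$$ That is, there exist constants $0 < c \le C$ and $N_0$ such that $c \log\log N \le H(X,Y\mid X\cdot Y) \le C \log\log N$ for all $N \ge N_0$.
   Context: $X \cdot Y$ denotes the ordinary integer product. $H$ denotes Shannon entropy with logarithms to base 2. $H(X,Y\mid X\cdot Y)$ is the conditional entropy (equivocation) of the ordered pair $(X,Y)$ given the product $X\cdot Y$; since $X \cdot Y$ is determined by $(X,Y)$, it equals $H(X,Y) - H(X\cdot Y)$. *)

(* Defs.v *)
From HB Require Import structures.
From mathcomp Require Import all_boot all_order all_algebra.
From mathcomp Require Import all_classical all_reals all_analysis.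

Set Implicit Arguments.
Unset Strict Implicit.
Unset Printing Implicit Defensive.

Import Order.TTheory GRing.Theory Num.Theory.

Local Open Scope classical_set_scope.
Local Open Scope ring_scope.

Definition log2 {R : realType} (x : R) : R := ln x / ln 2.

(* Shannon entropy of a probability mass function [p], as an extended real.
   The convention 0 * log 0 = 0 holds because [ln 0 = 0]. The terms are
   nonnegative since [0 <= p a <= 1], as [esum] requires. *)
Definition pmf_entropy {R : realType} {A : countType} (p : A -> R) : \bar R :=
  (\esum_(a in [set: A]) (- (p a * log2 (p a)))%:E)%E.

Section discrete_random_variables.
Context {d : measure_display} {T : measurableType d} {R : realType}.
Variable P : probability T R.

Definition cond_prob (E F : set T) : R := fine (P (E `&` F)) / fine (P F).

(* H(Z | W) = \sum_w P(W = w) H(Z | W = w), where H(Z | W = w) is the entropy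
   of the conditional law of Z given W = w; values w of probability zero
   contribute zero. [Z] and [W] are meant to have measurable level sets. *)
Definition cond_entropy {A B : countType} (Z : T -> A) (W : T -> B) : \bar R :=
  (\esum_(w in [set: B])
     (P (W @^-1` [set w]) *
      pmf_entropy
        (fun z : A => cond_prob (Z @^-1` [set z]) (W @^-1` [set w]))))%E.

Definition indep_RV {d1 d2 : measure_display}
    {T1 : measurableType d1} {T2 : measurableType d2}
    (X : {RV P >-> T1}) (Y : {RV P >-> T2}) : Prop :=
  forall (A : set T1) (B : set T2), measurable A -> measurable B ->
    (P (X @^-1` A `&` Y @^-1` B) = P (X @^-1` A) * P (Y @^-1` B))%E.

Definition uniform_1_to (N : nat) (X : {RV P >-> nat}) : Prop :=
  forall k : nat,
    P (X @^-1` [set k]) = (if (1 <= k <= N)%N then N%:R^-1 else 0)%:E.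

End discrete_random_variables.

(* Main.v *)
Require Import Defs.
From mathcomp Require Import all_boot all_order all_algebra.
From mathcomp Require Import all_classical all_reals all_analysis.
From mathcomp Require Import zify ring lra.

Import Order.TTheory GRing.Theory Num.Theory.
Local Open Scope classical_set_scope.
Local Open Scope ring_scope.

(** Let [rep N m] be the number of ordered factorizations [m = a * b] with
    [a, b <= N]. Given [X * Y = m] the pair is uniform on these factorizations,
    so the equivocation is the mean of [log2 (rep N (a * b))] over the box
    [1..N] x [1..N] (lemma [cond_entropy_prod]). Write [tau] for the number of
    divisors, [omega] for the number of distinct prime factors, and [L = ln N].
    Both bounds use concavity of the logarithm (the mean of the logarithms is at
    most the logarithm of the mean, [sum_ln_le]) together with the elementary
    estimate [sum_(n <= x) tau n <= x (1 + ln x)] ([sum_tau_le]).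

    Upper bound ([sum_ln_rep_le]): [rep N (a * b) <= tau (a * b) <= tau a * tau b],
    so the mean is at most twice the mean of [log2 (tau a)], hence at most
    [2 log2 (1 + L)].

    Lower bound ([sum_ln_rep_ge]): concavity is applied to the quotient
    [tau (a * b) / rep N (a * b)]. Summing it over the box cancels the
    multiplicity of each product, leaving at most
    [sum_(m <= N^2) tau m <= N^2 (1 + 2 L)]; so the mean of [log2 rep] is at
    least that of [log2 (tau (a * b))] minus [log2 (1 + 2 L)]. Since
    [log2 tau >= omega], and the mean of [omega (a * b)] over the box is at least
    [2 sum_(p <= N) 1/p - 3] ([sum_omega_ge]), where the prime sum is at least
    [ln L - 1] ([prime_recip_ge]), the mean of [log2 rep] is at least
    [2 ln L - log2 L - O(1)] with natural and binary logarithms mixed. As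
    [2 ln 2 > 1], this is a positive multiple of [ln L] for large [N]. In terms
    of entropy, this compares the law of the product with the distribution
    proportional to [tau] on [1..N^2]. *)

(** * Divisors, prime factors and factorizations inside a box *)

Definition tau (n : nat) : nat := size (divisors n).
Definition omega (n : nat) : nat := size (primes n).
Definition box (N : nat) : seq (nat * nat) :=
  [seq (a, b) | a <- index_iota 1 N.+1, b <- index_iota 1 N.+1].
Definition rep (N m : nat) : nat :=
  count (fun z : nat * nat => (z.1 * z.2)%N == m) (box N).

(** [divisors] is computed by folding [add_divisors] over the prime
    factorization, so this recovers [tau n] as the product of the
    exponents plus one. *)
Lemma size_add_divisors (f : nat * nat) (s : seq nat) :
  size (PrimeDecompAux.add_divisors f s) = (f.2.+1 * size s)%N.
Proof.
case: f => p e /=; rewrite /PrimeDecompAux.add_divisors.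
elim: e => [|e IH]; first by rewrite mul1n.
by rewrite iterS size_merge size_cat size_map IH addnC -mulSn.
Qed.

Lemma expn2_omega_le_tau (n : nat) : (2 ^ omega n <= tau n)%N.
Proof.
rewrite /omega /primes size_map /tau /divisors.
have: all (fun f : nat * nat => 0 < f.2)%N (prime_decomp n).
  by apply/allP => -[p e] /mem_prime_decomp[].
elim: (prime_decomp n) => //= f s IH /andP[f0 /IH s2].
by rewrite size_add_divisors expnS leq_mul.
Qed.

Lemma tau_gt0 (n : nat) : (0 < tau n)%N.
Proof. by rewrite (leq_trans _ (expn2_omega_le_tau n))// expn_gt0. Qed.

(** A divisor [d] of [a * b] is the product of [gcdn d a], which divides [a], and
    [d %/ gcdn d a], which divides [b] by Gauss's lemma. *)
Lemma tauM_le (a b : nat) : (0 < a)%N -> (0 < b)%N ->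
  (tau (a * b) <= tau a * tau b)%N.
Proof.
move=> a0 b0; rewrite /tau -(size_allpairs muln).
apply: uniq_leq_size; first exact: divisors_uniq.
move=> d; rewrite -dvdn_divisors ?muln_gt0 ?a0// => dab.
have d0 : (0 < d)%N by apply: dvdn_gt0 dab; rewrite muln_gt0 a0.
have g0 : (0 < gcdn d a)%N by rewrite gcdn_gt0 d0.
apply/allpairsP; exists (gcdn d a, d %/ gcdn d a)%N => /=; split.
- by rewrite -dvdn_divisors// dvdn_gcdr.
- rewrite -dvdn_divisors//.
  rewrite -(@Gauss_dvdr _ (a %/ gcdn d a)).
    rewrite -(dvdn_pmul2l g0) mulnA.
    by rewrite ![(gcdn d a * _)%N]mulnC !divnK ?dvdn_gcdr ?dvdn_gcdl.
  rewrite /coprime -(eqn_pmul2l g0) muln1 muln_gcdr.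
  by rewrite ![(gcdn d a * _)%N]mulnC !divnK ?dvdn_gcdr ?dvdn_gcdl.
- by rewrite mulnC divnK ?dvdn_gcdl.
Qed.

Lemma box_uniq N : uniq (box N).
Proof. by apply: allpairs_uniq => [||[? ?] [? ?]//]; exact: iota_uniq. Qed.

Lemma mem_box N (z : nat * nat) :
  (z \in box N) = (1 <= z.1 <= N)%N && (1 <= z.2 <= N)%N.
Proof.
case: z => a b; rewrite /box/=.
have -> : ((a, b) \in [seq (x, y) | x <- index_iota 1 N.+1,
   y <- index_iota 1 N.+1]) = (a \in index_iota 1 N.+1) && (b \in index_iota 1 N.+1).
  apply/allpairsP/andP => [[[x y] /= [hx hy [-> ->]]]//|[ha hb]].
  by exists (a, b).
by rewrite !mem_index_iota !ltnS.
Qed.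

Lemma rep_le_tau (N m : nat) : (0 < m)%N -> (rep N m <= tau m)%N.
Proof.
move=> m0; rewrite /rep -size_filter /tau -(size_map fst).
apply: uniq_leq_size.
  rewrite map_inj_in_uniq ?filter_uniq ?box_uniq// => -[a b] [c e].
  rewrite !mem_filter/= !mem_box/= => /andP[/eqP abm /andP[/andP[a0 _] _]].
  move=> /andP[/eqP cem _] ac; rewrite -ac in cem *; congr pair.
  by apply/eqP; rewrite -(eqn_pmul2l a0) abm cem.
move=> d /mapP[[a b]]; rewrite mem_filter/= => /andP[/eqP abm _] ->.
by rewrite -dvdn_divisors// -abm dvdn_mulr.
Qed.

Lemma rep_gt0 (N : nat) (z : nat * nat) :
  z \in box N -> (0 < rep N (z.1 * z.2))%N.
Proof. by move=> zN; rewrite -has_count; apply/hasP; exists z. Qed.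

(** Count the pairs [(d, n)] with [d] dividing [n] in both orders. *)
Lemma sum_tau (x : nat) :
  (\sum_(1 <= n < x.+1) tau n = \sum_(1 <= d < x.+1) x %/ d)%N.
Proof.
under [RHS]eq_bigr do rewrite divn_count_dvd.
rewrite exchange_big/=; apply: eq_big_nat => n /andP[n0 nx].
rewrite -big_mkcond/= sum1_count -size_filter /tau.
apply/perm_size/uniq_perm; rewrite ?divisors_uniq ?filter_uniq ?iota_uniq// => d.
rewrite mem_filter mem_index_iota -dvdn_divisors//.
by case: (boolP (d %| n)%N) => //= dn; have := dvdn_leq n0 dn; have := dvdn_gt0 n0 dn; lia.
Qed.

(** * Concavity of the logarithm and the divisor sum *)
Section analytic.
Context {R : realType}.
Implicit Types (x y : R) (N n k p : nat).

Lemma ln_le_subr1 x : 0 < x -> ln x <= x - 1.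
Proof. by move=> x0; rewrite -{1}(subrKC 1 x) le_ln1Dx// ltrBrDl subrr. Qed.

Lemma ler_sum_subseq (I : eqType) (s t : seq I) (f : I -> R) :
  uniq s -> uniq t -> {subset s <= t} -> (forall i, 0 <= f i) ->
  \sum_(i <- s) f i <= \sum_(i <- t) f i.
Proof.
move=> us ut st f0; rewrite [leRHS](bigID [in s])/=.
have ps : perm_eq [seq i <- t | i \in s] s.
  rewrite uniq_perm ?filter_uniq// => i; rewrite mem_filter.
  by case: (boolP (i \in s)) => // /st.
by rewrite -[X in X + _]big_filter (perm_big _ ps)/= lerDl sumr_ge0.
Qed.

Lemma sumr_const_seq (I : Type) (s : seq I) (c : R) :
  \sum_(i <- s) c = (size s)%:R * c.
Proof. by rewrite big_const_seq count_predT iter_addr_0 mulr_natl. Qed.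

(** Jensen's inequality for the logarithm: with [A] the mean of [f], sum
    [ln (f i / A) <= f i / A - 1], whose right-hand sides add up to zero. *)
Lemma sum_ln_le (I : eqType) (s : seq I) (f : I -> R) :
  (forall i, i \in s -> 0 < f i) ->
  \sum_(i <- s) ln (f i) <= (size s)%:R * ln ((\sum_(i <- s) f i) / (size s)%:R).
Proof.
case: s => [|i0 s0]; first by rewrite !big_nil mul0r.
set s := i0 :: s0 => f0.
set n : R := (size s)%:R; set A := _ / n.
have n0 : 0 < n by rewrite ltr0n.
have sf0 : 0 < \sum_(i <- s) f i.
  rewrite big_cons ltr_pwDl ?f0 ?mem_head// big_seq sumr_ge0// => i si.
  by rewrite ltW// f0// in_cons si orbT.
have A0 : 0 < A by rewrite divr_gt0.
rewrite -sumr_const_seq -subr_le0 -sumrB.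
apply: (@le_trans _ _ (\sum_(i <- s) (f i / A - 1))); last first.
  by rewrite sumrB sumr_const_seq mulr1 -mulr_suml /A invf_div mulrCA divff ?mulr1 ?subrr// gt_eqF.
rewrite big_seq [leRHS]big_seq; apply: ler_sum => i si.
by rewrite -ln_div ?posrE ?f0// ln_le_subr1// divr_gt0// f0.
Qed.

Lemma harmonic_le N : (0 < N)%N ->
  \sum_(1 <= k < N.+1) k%:R^-1 <= 1 + ln N%:R :> R.
Proof.
elim: N => // -[|N] IH _; first by rewrite big_nat1 invr1 ln1 addr0.
rewrite big_nat_recr//= (le_trans (lerD (IH isT) (lexx _)))// -addrA lerD2l.
have a0 : (0 : R) < N.+1%:R by rewrite ltr0n.
have b0 : (0 : R) < N.+2%:R by rewrite ltr0n.
rewrite addrC -lerBrDr -lerN2 opprB -ln_div ?posrE//.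
rewrite (le_trans (ln_le_subr1 _ _))// ?divr_gt0//.
rewrite -(natr1 N.+1) in b0 *.
by rewrite le_eqVlt; apply/orP; left; apply/eqP; field; rewrite gt_eqF.
Qed.

Lemma ln_le_harmonic N : ln N.+1%:R <= \sum_(1 <= k < N.+1) k%:R^-1 :> R.
Proof.
elim: N => [|N IH]; first by rewrite big_geq// ln1.
rewrite big_nat_recr//= (le_trans _ (lerD IH (lexx _)))//.
have a0 : (0 : R) < N.+1%:R by rewrite ltr0n.
have b0 : (0 : R) < N.+2%:R by rewrite ltr0n.
rewrite addrC -lerBlDr -ln_div ?posrE// (le_trans (ln_le_subr1 _ _))// ?divr_gt0//.
rewrite -(natr1 N.+1).
by rewrite le_eqVlt; apply/orP; left; apply/eqP; field; rewrite gt_eqF.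
Qed.

Lemma sum_tau_le N : (0 < N)%N ->
  \sum_(1 <= n < N.+1) (tau n)%:R <= N%:R * (1 + ln N%:R) :> R.
Proof.
move=> N0; rewrite -natr_sum sum_tau natr_sum.
rewrite (le_trans _ (ler_wpM2l _ (harmonic_le _ N0)))// mulr_sumr.
rewrite big_nat [leRHS]big_nat; apply: ler_sum => d /andP[d0 _].
by rewrite ler_pdivlMr ?ltr0n// -natrM ler_nat leq_divM.
Qed.

(** * The sum of the reciprocals of the primes *)

Definition smooth (k n : nat) : bool := all (fun p => p < k)%N (primes n).

(** A [p.+1]-smooth [n] is [p]-smooth when [p] does not divide it; otherwise it is
    [p * m] with [m] again [p.+1]-smooth. This one-prime step of the Euler product
    needs only finite sums. *)
Lemma smooth_sum_step (p N : nat) : prime p ->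
  \sum_(1 <= n < N.+1 | smooth p.+1 n) n%:R^-1 <=
  \sum_(1 <= n < N.+1 | smooth p n) n%:R^-1 +
  p%:R^-1 * \sum_(1 <= n < N.+1 | smooth p.+1 n) n%:R^-1 :> R.
Proof.
move=> pp; have p0 := prime_gt0 pp.
rewrite [leLHS](bigID (fun n => p %| n)%N)/= [leLHS]addrC lerD//.
  rewrite le_eqVlt; apply/orP; left; apply/eqP.
  apply: congr_big_nat => // n /andP[n0 _].
  apply/andP/idP => [[/allP sn pn]|/allP sn].
    apply/allP => q qn; have := sn _ qn; rewrite ltnS leq_eqVlt => /orP[/eqP qp|//].
    by move: qn; rewrite qp mem_primes (negbTE pn) !andbF.
  split; first by apply/allP => q /sn /leqW.
  apply/negP => pn; have /sn : (p \in primes n) by rewrite mem_primes pp n0.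
  by rewrite ltnn.
pose s := [seq n <- index_iota 1 N.+1 | smooth p.+1 n && (p %| n)%N].
rewrite -[leLHS]big_filter -/s -[X in _ * X]big_filter mulr_sumr.
have -> : \sum_(n <- s) n%:R^-1 =
    \sum_(m <- [seq (n %/ p)%N | n <- s]) p%:R^-1 / m%:R :> R.
  rewrite big_map big_seq [RHS]big_seq; apply: eq_bigr => n.
  rewrite mem_filter => /andP[/andP[_ pn] _].
  by rewrite -invfM -natrM mulnC divnK.
apply: ler_sum_subseq; rewrite ?filter_uniq ?iota_uniq//.
- rewrite map_inj_in_uniq ?filter_uniq ?iota_uniq// => m n.
  rewrite !mem_filter => /andP[/andP[_ pm] _] /andP[/andP[_ pn] _] mn.
  by rewrite -(divnK pm) -(divnK pn) mn.
- move=> m /mapP[n]; rewrite !mem_filter !mem_index_iota !ltnS.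
  move=> /andP[/andP[/allP sn pn] /andP[n0 nN]] ->.
  have m0 : (0 < n %/ p)%N by rewrite divn_gt0// dvdn_leq.
  rewrite m0 (leq_trans (leq_div _ _)) ?andbT//.
  apply/allP => q; rewrite mem_primes => /and3P[pq _ qm].
  apply: sn; rewrite mem_primes pq n0/=.
  by rewrite -(divnK pn) dvdn_mulr.
Qed.

(** Each prime [p] multiplies the smooth sum by at most
    [(1 - 1/p)^-1 = 1 + 1/(p-1) <= expR (1/(p-1))]. *)
Lemma smooth_sum_le (N k : nat) :
  \sum_(1 <= n < N.+1 | smooth k n) n%:R^-1 <=
  expR (\sum_(0 <= p < k | prime p) p.-1%:R^-1) :> R.
Proof.
elim: k => [|k IH].
  rewrite [in leRHS]big_geq// expR0.
  rewrite -big_filter (@le_trans _ _ (\sum_(n <- [:: 1%N]) n%:R^-1))//; last first.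
    by rewrite big_seq1 invr1.
  apply: ler_sum_subseq; rewrite ?filter_uniq ?iota_uniq// => n.
  rewrite mem_filter mem_index_iota mem_seq1 => /andP[sn /andP[n0 _]].
  rewrite eqn_leq n0 andbT leqNgt; apply/negP => n1.
  have /(allP sn) : (pdiv n \in primes n) by rewrite pi_pdiv.
  by rewrite ltn0.
have [pk|npk] := boolP (prime k); last first.
  rewrite [in leRHS]big_mkcond/= big_nat_recr//= (negbTE npk) addr0 -big_mkcond/=.
  rewrite (le_trans _ IH)// le_eqVlt; apply/orP; left; apply/eqP.
  apply: eq_bigl => n; apply: eq_in_all => q; rewrite mem_primes => /and3P[pq _ _].
  by rewrite ltnS leq_eqVlt; case: eqP => // qk; rewrite -qk pq in npk.
rewrite [in leRHS]big_mkcond/= big_nat_recr//= pk -big_mkcond/= expRD.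
have step := smooth_sum_step k N pk.
set A := \sum_(_ <= n < _ | smooth k.+1 n) _ in step *.
have k1 : (0 : R) < k.-1%:R by rewrite ltr0n; have := prime_gt1 pk; lia.
have kE : k%:R = k.-1%:R + 1 :> R by rewrite natr1 prednK// prime_gt0.
rewrite kE in step; set y : R := k.-1%:R in k1 step *.
apply: (@le_trans _ _ (expR (\sum_(0 <= p < k | prime p) p.-1%:R^-1) * (1 + y^-1))).
  rewrite -[leLHS]mul1r -ler_pdivrMr ?ltr_wpDr ?invr_ge0 ?(ltW k1)//.
  have -> : 1 * A / (1 + y^-1) = A - (y + 1)^-1 * A.
    field; rewrite !gt_eqF//; lra.
  by rewrite lerBlDr (le_trans step)// lerD2r.
by rewrite ler_wpM2l ?expR_ge0// expR_ge1Dx.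
Qed.

Definition prime_recip (N : nat) : R :=
  \sum_(0 <= p < N.+1 | prime p) p%:R^-1.

(** Over all integers from 2 on, these differences telescope. *)
Lemma sum_prime_telescope (k : nat) :
  \sum_(0 <= p < k.+2 | prime p) (p.-1%:R^-1 - p%:R^-1) <= 1 - k.+1%:R^-1 :> R.
Proof.
elim: k => [|k IH]; first by rewrite /index_iota/= !big_cons big_nil/= invr1 subrr.
rewrite big_mkcond big_nat_recr//= -big_mkcond/=.
have d0 : 0 <= k.+1%:R^-1 - k.+2%:R^-1 :> R.
  by rewrite subr_ge0 lef_pV2 ?posrE ?ltr0n// ler_nat.
apply: (@le_trans _ _ (1 - k.+1%:R^-1 + (k.+1%:R^-1 - k.+2%:R^-1))); last by rewrite addrA subrK.
by apply: lerD => //; case: ifP.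
Qed.

Lemma sum_prime_telescope_le1 (N : nat) :
  \sum_(0 <= p < N.+1 | prime p) (p.-1%:R^-1 - p%:R^-1) <= 1 :> R.
Proof.
case: N => [|N]; first by rewrite big_mkcond big_nat1/=.
by rewrite (le_trans (sum_prime_telescope N))// gerBl invr_ge0.
Qed.

(** Every [n <= N] is [N.+1]-smooth, so the Euler product bounds the harmonic sum;
    replacing [1/(p-1)] by [1/p] costs at most 1 in total. *)
Lemma prime_recip_ge (N : nat) : (0 < N)%N ->
  ln (ln N.+1%:R) - 1 <= prime_recip N.
Proof.
move=> N0; have l0 : 0 < ln N.+1%:R :> R by rewrite ln_gt0// ltr1n.
rewrite lerBlDr -ler_expR lnK ?posrE//.
rewrite (le_trans (ln_le_harmonic N))//.
apply: (@le_trans _ _ (\sum_(1 <= n < N.+1 | smooth N.+1 n) n%:R^-1)).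
  rewrite le_eqVlt; apply/orP; left; apply/eqP.
  apply: congr_big_nat => // n /andP[n0 nN].
  symmetry; apply/allP => p; rewrite mem_primes => /and3P[_ _ /dvdn_leq].
  by move=> /(_ n0) pn; rewrite (leq_ltn_trans pn).
rewrite (le_trans (smooth_sum_le _ _))// ler_expR -lerBlDl.
by rewrite /prime_recip -sumrB sum_prime_telescope_le1.
Qed.

(** [1/p^2 <= 1/(p-1) - 1/p]. *)
Lemma sum_invsq_prime_le1 (N : nat) :
  \sum_(0 <= p < N.+1 | prime p) (p%:R^-1) ^+ 2 <= 1 :> R.
Proof.
rewrite (le_trans _ (sum_prime_telescope_le1 N))//; apply: ler_sum => p pp.
have p1 : (0 : R) < p.-1%:R by rewrite ltr0n; have := prime_gt1 pp; lia.
have pE : p%:R = p.-1%:R + 1 :> R by rewrite natr1 prednK// prime_gt0.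
rewrite pE; set y : R := p.-1%:R in p1 *.
have -> : y^-1 - (y + 1)^-1 = (y + 1)^-1 ^+ 2 * ((y + 1) / y).
  field; rewrite !gt_eqF//; lra.
by rewrite ler_peMr ?sqr_ge0// ler_pdivlMr// mul1r lerDl.
Qed.

(** Inclusion-exclusion: for a prime [p], each summand is the indicator of
    [p] dividing [z.1 * z.2]. *)
Lemma omega_mul_ge (N : nat) (z : nat * nat) : z \in box N ->
  \sum_(0 <= p < N.+1 | prime p)
    ((p %| z.1)%N%:R + (p %| z.2)%N%:R - (p %| z.1)%N%:R * (p %| z.2)%N%:R)
  <= (omega (z.1 * z.2))%:R :> R.
Proof.
case: z => a b; rewrite mem_box/= => /andP[/andP[a0 _] /andP[b0 _]].
apply: (@le_trans _ _ (\sum_(0 <= p < N.+1 | prime p && (p %| a * b)%N) 1)).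
  rewrite big_mkcondr/=; apply: ler_sum => p pp; rewrite Euclid_dvdM//.
  by case: (p %| a)%N; case: (p %| b)%N; rewrite /= ?mulr0 ?mulr1 ?mul0r ?subr0 ?addr0 ?add0r ?addrK.
rewrite -(natr_sum _ _ _ (fun=> 1%N)) sum1_count -size_filter ler_nat.
apply: uniq_leq_size; rewrite ?filter_uniq ?iota_uniq// => p.
by rewrite mem_filter mem_primes => /andP[/andP[-> ->] _]; rewrite muln_gt0 a0 b0.
Qed.

Lemma sum_box (N : nat) (f : nat -> nat -> R) :
  \sum_(z <- box N) f z.1 z.2 =
  \sum_(1 <= a < N.+1) \sum_(1 <= b < N.+1) f a b.
Proof. by rewrite big_allpairs. Qed.

(** After exchanging the sums, a prime [p] contributes [2 N f - f^2] with
    [f = N %/ p], which is at least [N^2 (2/p - 1/p^2) - 2 N]. Of the constant 3,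
    the roundings [2 N] (at most [N] primes) cost 2 and the squares cost 1. *)
Lemma sum_omega_ge (N : nat) : (0 < N)%N ->
  N%:R ^+ 2 * (2 * prime_recip N - 3) <=
  \sum_(z <- box N) (omega (z.1 * z.2))%:R.
Proof.
move=> N0; have N0R : (0 : R) < N%:R by rewrite ltr0n.
rewrite big_seq (le_trans _ (ler_sum _ (omega_mul_ge N)))// -big_seq exchange_big/=.
apply: (@le_trans _ _ (\sum_(0 <= p < N.+1 | prime p)
   (2 * N%:R * (N %/ p)%:R - (N %/ p)%:R ^+ 2))); last first.
  apply: ler_sum => p _.
  rewrite (sum_box _ (fun a b => (p %| a)%:R + (p %| b)%:R - (p %| a)%:R * (p %| b)%:R)).
  have cnt : \sum_(1 <= a < N.+1) (p %| a)%N%:R = (N %/ p)%:R :> R.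
    by rewrite -natr_sum -divn_count_dvd.
  have cst (c : R) : \sum_(1 <= a < N.+1) c = N%:R * c.
    by rewrite sumr_const_seq size_iota subn1.
  under eq_bigr do rewrite sumrB big_split/= -mulr_sumr cnt cst.
  rewrite sumrB big_split/= -mulr_suml -mulr_sumr cnt cst.
  rewrite le_eqVlt; apply/orP; left; apply/eqP.
  by move: (N%:R) ((N %/ p)%:R) => x f; ring.
apply: (@le_trans _ _ (\sum_(0 <= p < N.+1 | prime p)
   (N%:R ^+ 2 * (2 * p%:R^-1 - p%:R^-1 ^+ 2) - 2 * N%:R))); last first.
  apply: ler_sum => p pp.
  have p0 : (0 : R) < p%:R by rewrite ltr0n prime_gt0.
  set u : R := N%:R / p%:R.
  have f1 : (N %/ p)%:R <= u by rewrite ler_pdivlMr// -natrM ler_nat leq_divM.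
  have f2 : u - 1 <= (N %/ p)%:R.
    rewrite lerBlDr natr1 ltW// ltr_pdivrMr// -natrM ltr_nat ltn_ceil// prime_gt0//.
  have f0 : (0 : R) <= (N %/ p)%:R by [].
  have -> : N%:R ^+ 2 * (2 * p%:R^-1 - p%:R^-1 ^+ 2) = 2 * N%:R * u - u ^+ 2.
    by rewrite /u; field; rewrite gt_eqF.
  have : (N %/ p)%:R ^+ 2 <= u ^+ 2 by rewrite lerXn2r// nnegrE (le_trans f0).
  nra.
rewrite sumrB -mulr_sumr sumrB -mulr_sumr -/(prime_recip N).
have q1 := sum_invsq_prime_le1 N.
have c1 : \sum_(0 <= p < N.+1 | prime p) 2 * N%:R <= 2 * N%:R ^+ 2 :> R.
  rewrite big_mkcond big_nat_recl//= add0r.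
  apply: (@le_trans _ _ (\sum_(0 <= p < N) 2 * N%:R)).
    by apply: ler_sum => p _; case: ifP => // _; rewrite mulr_ge0.
  by rewrite sumr_const_seq size_iota subn0 expr2 mulrCA.
have : N%:R ^+ 2 * \sum_(0 <= p < N.+1 | prime p) p%:R^-1 ^+ 2 <= N%:R ^+ 2 :> R.
  by rewrite ler_piMr// sqr_ge0.
rewrite mulrBr; lra.
Qed.
End analytic.

(** * The mean of the logarithm of the number of factorizations *)

Section mean_log_rep.
Context {R : realType}.

Lemma size_box (N : nat) : size (box N) = (N ^ 2)%N.
Proof. by rewrite size_allpairs !size_iota subn1 mulnn. Qed.

Lemma sum_box_fiber (N : nat) (F : nat -> R) :
  \sum_(z <- box N) F (z.1 * z.2)%N =
  \sum_(1 <= m < (N ^ 2).+1) (rep N m)%:R * F m.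
Proof.
transitivity (\sum_(z <- box N)
    \sum_(1 <= m < (N ^ 2).+1) ((z.1 * z.2)%N == m)%:R * F m).
  rewrite big_seq [RHS]big_seq; apply: eq_bigr => -[a b].
  rewrite mem_box/= => /andP[/andP[a0 aN] /andP[b0 bN]].
  rewrite (bigD1_seq (a * b)%N) ?iota_uniq//=; last first.
    by rewrite mem_index_iota muln_gt0 a0 b0 ltnS -mulnn leq_mul.
  rewrite eqxx mul1r big1 ?addr0// => m.
  by rewrite eq_sym => /negbTE ->; rewrite mul0r.
rewrite exchange_big/=; apply: eq_bigr => m _.
rewrite -mulr_suml -natr_sum /rep -sum1_count; congr (_%:R * _).
by rewrite [RHS]big_mkcond; apply: eq_bigr => z _ /=; case: eqP.
Qed.

Lemma rep_gt0R (N : nat) (z : nat * nat) :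
  z \in box N -> (0 : R) < (rep N (z.1 * z.2))%:R.
Proof. by move=> /rep_gt0; rewrite ltr0n. Qed.

Lemma tau_gt0R (n : nat) : (0 : R) < (tau n)%:R.
Proof. by rewrite ltr0n tau_gt0. Qed.

Lemma sum_ln_rep_le (N : nat) : (0 < N)%N ->
  \sum_(z <- box N) ln (rep N (z.1 * z.2))%:R <=
  N%:R ^+ 2 * (2 * ln (1 + ln N%:R)) :> R.
Proof.
move=> N0; have N0R : (0 : R) < N%:R by rewrite ltr0n.
apply: (@le_trans _ _ (\sum_(z <- box N) (ln (tau z.1)%:R + ln (tau z.2)%:R))).
  rewrite big_seq [leRHS]big_seq; apply: ler_sum => -[a b] zN.
  have /= r0 := rep_gt0R N _ zN.
  move: zN; rewrite mem_box/= => /andP[/andP[a0 _] /andP[b0 _]].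
  rewrite -lnM ?posrE ?tau_gt0R// ler_ln ?posrE ?mulr_gt0 ?tau_gt0R//.
  rewrite -natrM ler_nat (leq_trans (rep_le_tau _ _ _)) ?tauM_le//.
  by rewrite muln_gt0 a0.
rewrite (sum_box _ (fun a b => ln (tau a)%:R + ln (tau b)%:R)).
have cst (c : R) : \sum_(1 <= a < N.+1) c = N%:R * c.
  by rewrite sumr_const_seq size_iota subn1.
under eq_bigr do rewrite big_split/= cst.
rewrite big_split/= -mulr_sumr cst.
set T := \sum_(1 <= a < N.+1) _.
suff : N%:R * T <= N%:R * (N%:R * ln (1 + ln N%:R)) by lra.
rewrite ler_wpM2l// /T.
rewrite (le_trans (sum_ln_le _ _ _ _)) => [|i _|]; rewrite ?tau_gt0R//.
rewrite size_iota subn1/= ler_wpM2l//.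
have l0 : (0 : R) <= ln N%:R by rewrite ln_ge0// ler1n.
have s0 : (0 : R) < \sum_(1 <= i < N.+1) (tau i)%:R.
  by rewrite big_nat_recl// ltr_pwDl ?tau_gt0R ?sumr_ge0.
rewrite ler_ln ?posrE ?divr_gt0 ?ltr_pwDl//.
by rewrite ler_pdivrMr// mulrC sum_tau_le.
Qed.

(** Each product [m] is hit by exactly [rep N m] points of the box, so dividing
    by [rep N m] counts it at most once. *)
Lemma sum_tau_div_rep_le (N : nat) :
  \sum_(z <- box N) (tau (z.1 * z.2))%:R / (rep N (z.1 * z.2))%:R <=
  \sum_(1 <= m < (N ^ 2).+1) (tau m)%:R :> R.
Proof.
rewrite (sum_box_fiber _ (fun m => (tau m)%:R / (rep N m)%:R)).
apply: ler_sum => m _; rewrite mulrCA.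
by have [->|r0] := eqVneq (rep N m)%:R (0 : R); rewrite ?mul0r ?mulr0// divff ?mulr1.
Qed.

Lemma sum_ln_rep_ge (N : nat) : (0 < N)%N ->
  N%:R ^+ 2 * (ln 2 * (2 * prime_recip N - 3) - ln (1 + 2 * ln N%:R)) <=
  \sum_(z <- box N) ln (rep N (z.1 * z.2))%:R :> R.
Proof.
move=> N0; have N0R : (0 : R) < N%:R by rewrite ltr0n.
have N20 : (0 < N ^ 2)%N by rewrite expn_gt0 N0.
have l0 : (0 : R) <= ln N%:R by rewrite ln_ge0// ler1n.
have ratio : \sum_(z <- box N)
    ln ((tau (z.1 * z.2))%:R / (rep N (z.1 * z.2))%:R) <=
    N%:R ^+ 2 * ln (1 + 2 * ln N%:R) :> R.
  rewrite (le_trans (sum_ln_le _ _ _ _))//.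
    by move=> z zN; rewrite divr_gt0 ?tau_gt0R ?rep_gt0R.
  rewrite size_box natrX ler_wpM2l ?sqr_ge0//.
  have s0 : (0 : R) < \sum_(z <- box N) (tau (z.1 * z.2))%:R / (rep N (z.1 * z.2))%:R.
    have z1 : (1, 1)%N \in box N by rewrite mem_box/= N0.
    rewrite (bigD1_seq _ z1 (box_uniq N))/= ltr_pwDl//.
      by rewrite divr_gt0 ?tau_gt0R// (rep_gt0R _ (1, 1)%N).
    by rewrite sumr_ge0// => z _; rewrite divr_ge0.
  rewrite ler_ln ?posrE ?divr_gt0 ?ltr_pwDl ?mulr_ge0 ?exprn_gt0//.
  rewrite ler_pdivrMr ?exprn_gt0// (le_trans (sum_tau_div_rep_le N))//.
  rewrite (le_trans (sum_tau_le _ N20))// natrX lnXn// mulrC.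
  by rewrite mulr_natl.
have tau_ge : N%:R ^+ 2 * (ln 2 * (2 * prime_recip N - 3)) <=
    \sum_(z <- box N) ln (tau (z.1 * z.2))%:R :> R.
  rewrite mulrCA (le_trans (ler_wpM2l _ (sum_omega_ge _ N0)))//.
    by rewrite ln_ge0// ler1n.
  rewrite mulr_sumr; apply: ler_sum => z _.
  rewrite mulr_natr -lnXn// ler_ln ?posrE ?exprn_gt0 ?tau_gt0R//.
  by rewrite -natrX ler_nat expn2_omega_le_tau.
rewrite mulrBr lerBlDr (le_trans tau_ge)// -lerBlDl (le_trans _ ratio)//.
rewrite -sumrB big_seq [leRHS]big_seq; apply: ler_sum => z zN.
by rewrite ln_div ?posrE ?tau_gt0R ?rep_gt0R.
Qed.

(** The main term of the lower bound is [(2 ln 2 - 1) ln L], so this is what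
    makes it positive. It follows from [ln x >= 1 - 1/x] applied to the
    factors of [4 = 4/3 * 3/2 * 2], as [1/4 + 1/3 + 1/2 > 1]. *)
Lemma ln2_gt_half : 1 / 2 < ln 2 :> R.
Proof.
have inv (x : R) : 0 < x -> 1 - x^-1 <= ln x.
  by move=> x0; have := ln_le_subr1 x^-1; rewrite invr_gt0 lnV ?posrE// => /(_ x0); lra.
have l4 : ln 2 + ln 2 = ln (4 / 3) + ln (3 / 2) + ln 2 :> R.
  by rewrite -!lnM ?posrE; [congr ln; field|lra..].
have := inv (4 / 3); have := inv (3 / 2); have := inv 2.
have -> : (4 / 3)^-1 = 3 / 4 :> R by field.
have -> : (3 / 2)^-1 = 2 / 3 :> R by field.
lra.
Qed.

Lemma ln2_le1 : ln 2 <= 1 :> R.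
Proof. by have := ln_le_subr1 (2 : R); lra. Qed.

Lemma ln_div_ln2 (L : R) : 0 < L ->
  ln L <= ln (L / ln 2) <= ln L + ln 2.
Proof.
move=> L0; have h := ln2_gt_half; have h1 := ln2_le1.
have l0 : 0 < ln 2 :> R by lra.
rewrite ler_ln ?posrE ?divr_gt0// -lnM ?posrE// ler_ln ?posrE ?divr_gt0 ?mulr_gt0//.
rewrite ler_pdivlMr// ler_pdivrMr// -mulrA.
by rewrite ler_piMr ?(ltW L0)//= ler_peMr ?(ltW L0)//; lra.
Qed.

(** With [c = ln 2 - 1/2] and [L = ln N], the lower bound of [sum_ln_rep_ge] is at
    least [2 c ln L - 5 ln 2 - ln 3]. Half of the main term is kept; the other
    half exceeds the constants, including the [c ln 2] lost by passing from
    [ln L] to [ln (L / ln 2)], as soon as [c ln L >= 8]. *)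
Lemma mean_ln_rep_bounds (N : nat) : (1 <= N)%N ->
  expR (expR (8 / (ln 2 - 1 / 2) : R)) <= N%:R ->
  N%:R ^+ 2 * ((ln 2 - 1 / 2) * ln (ln N%:R / ln 2)) <=
    \sum_(z <- box N) ln ((rep N (z.1 * z.2))%:R : R) <=
  N%:R ^+ 2 * (4 * ln (ln N%:R / ln 2)).
Proof.
have h := ln2_gt_half; have h1 := ln2_le1.
set c : R := ln 2 - 1 / 2; have c0 : 0 < c by rewrite /c; lra.
set K := 8 / c => N0 NK.
have cK : c * K = 8 by rewrite mulrC divfK// gt_eqF.
have N0R : (0 : R) < N%:R by rewrite ltr0n.
set L : R := ln N%:R.
have LK : expR K <= L by rewrite /L -ler_expR lnK ?posrE.
have L0 : 0 < L by rewrite (lt_le_trans (expR_gt0 _) LK).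
have lLK : K <= ln L by rewrite -ler_expR lnK ?posrE.
have K1 : 1 <= K by rewrite ler_pdivlMr// mul1r /c; lra.
have L2 : 2 <= L by rewrite (le_trans _ LK)// (le_trans _ (expR_ge1Dx _))//; lra.
have /andP[l1 l2] := ln_div_ln2 _ L0.
apply/andP; split.
  rewrite (le_trans _ (sum_ln_rep_ge _ N0))// ler_wpM2l ?sqr_ge0//.
  have S1 : ln L - 1 <= prime_recip N.
    rewrite (le_trans _ (prime_recip_ge _ N0))// lerB//.
    have LN : L <= ln N.+1%:R by rewrite /L ler_ln ?posrE// ler_nat.
    by rewrite ler_ln// posrE (lt_le_trans L0).
  have l3 : ln (1 + 2 * L) <= ln 3 + ln L.
    rewrite -lnM ?posrE// ler_ln ?posrE ?mulr_gt0//; lra.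
  have l4 : ln 3 <= 2 :> R by have := ln_le_subr1 (3 : R); lra.
  rewrite -/L.
  have e1 : c * ln (L / ln 2) <= c * ln L + 1.
    rewrite (le_trans (ler_wpM2l (ltW c0) l2))// mulrDr lerD2l.
    by apply: mulr_ile1; rewrite /c; lra.
  have e2 : ln 2 * (2 * (ln L - 1) - 3) <= ln 2 * (2 * prime_recip N - 3).
    by rewrite ler_wpM2l//; lra.
  have e3 : c * K <= c * ln L by rewrite ler_wpM2l// ltW.
  have e4 : ln 2 * (2 * (ln L - 1) - 3) = 2 * (c * ln L) + ln L - 5 * ln 2.
    by rewrite /c; field.
  lra.
rewrite (le_trans (sum_ln_rep_le _ N0))// ler_wpM2l ?sqr_ge0// -/L.
(* The constant 4: twice the exponent in [1 + L <= L ^+ 2], valid for [2 <= L]. *)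
have : ln (1 + L) <= ln (L ^+ 2).
  by rewrite ler_ln ?posrE ?exprn_gt0//; [nra|lra].
by rewrite lnXn// mulr2n; lra.
Qed.
End mean_log_rep.

(** * From the conditional entropy to the box *)

Section entropy.
Context {R : realType}.

Lemma esum_seq (A : choiceType) (s : seq A) (a : A -> \bar R) :
  uniq s -> (forall x, (0 <= a x)%E) -> (forall x, x \notin s -> a x = 0%E) ->
  \esum_(x in [set: A]) a x = (\sum_(x <- s) a x)%E.
Proof.
move=> us a0 as0; rewrite [RHS](fsbig_seq _ _ us) -(esum_fset (finite_seq s))//.
rewrite [RHS]esum_mkcond; apply: eq_esum => x _.
by case: ifPn => // xs; rewrite as0//; apply: contraNN xs; rewrite mem_setE.
Qed.

Lemma pmf_entropy_uniform (A : countType) (s : seq A) (p : A -> R) :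
  uniq s -> (0 < size s)%N ->
  (forall x, p x = if x \in s then (size s)%:R^-1 else 0) ->
  pmf_entropy p = (log2 (size s)%:R)%:E.
Proof.
move=> us s0 pE; have n0 : (0 : R) < (size s)%:R by rewrite ltr0n.
have n1 : (1 : R) <= (size s)%:R by rewrite ler1n.
have l2 : 0 < ln 2 :> R by rewrite ln_gt0// ltr1n.
have tE x : x \in s ->
    - (p x * log2 (p x)) = (size s)%:R^-1 * log2 (size s)%:R.
  by move=> xs; rewrite pE xs /log2 lnV ?posrE// mulNr mulrN opprK.
rewrite /pmf_entropy (esum_seq _ s)//.
- rewrite big_seq (eq_bigr (fun=> ((size s)%:R^-1 * log2 (size s)%:R)%:E)).
    rewrite -big_seq sumEFin sumr_const_seq.
    by rewrite mulrA divff ?mul1r// gt_eqF.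
  by move=> x xs; rewrite tE.
- move=> x; rewrite lee_fin; have [xs|xs] := boolP (x \in s).
    by rewrite tE// mulr_ge0 ?invr_ge0// divr_ge0 ?(ltW l2) ?ln_ge0.
  by rewrite pE (negbTE xs) mul0r oppr0.
- by move=> x xs; rewrite pE (negbTE xs) mul0r oppr0.
Qed.

Section product.
Context {d : measure_display} {T : measurableType d}.
Variables (P : probability T R) (N : nat) (X Y : {RV P >-> nat}).
Hypotheses (N0 : (0 < N)%N) (uX : uniform_1_to N X) (uY : uniform_1_to N Y).
Hypothesis (iXY : indep_RV X Y).

Let Z t : nat * nat := (X t, Y t).
Let W t : nat := (X t * Y t)%N.

Lemma preimage_pair (z : nat * nat) :
  Z @^-1` [set z] = X @^-1` [set z.1] `&` Y @^-1` [set z.2].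
Proof.
case: z => a b; apply/seteqP; split => t /=; first by case=> <- <-.
by rewrite /Z; case=> -> ->.
Qed.

Lemma measurable_preim_nat (V : {RV P >-> nat}) (B : set nat) :
  measurable (V @^-1` B).
Proof. by rewrite -[X in measurable X]setTI; exact: measurable_funP. Qed.

Lemma measurable_pair (z : nat * nat) : measurable (Z @^-1` [set z]).
Proof. by rewrite preimage_pair; apply: measurableI; exact: measurable_preim_nat. Qed.

(** Slicing along the values of [X] presents the level set as a countable union
    of rectangles. *)
Lemma measurable_prod (w : nat) : measurable (W @^-1` [set w]).
Proof.
have -> : W @^-1` [set w] =
    \bigcup_k (X @^-1` [set k] `&` Y @^-1` [set b | (k * b)%N = w]).
  apply/seteqP; split => t /=; first by move=> wt; exists (X t).
  by case=> k _ [/= <-].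
by apply: bigcupT_measurable => k; apply: measurableI; exact: measurable_preim_nat.
Qed.

Lemma prob_pair (z : nat * nat) :
  P (Z @^-1` [set z]) = (if z \in box N then N%:R ^- 2 else 0)%:E.
Proof.
rewrite preimage_pair iXY// uX uY mem_box.
by do 2?case: ifP => _; rewrite -EFinM ?mulr0 ?mul0r// expr2 invfM.
Qed.

(** The box carries all the mass of the pair, because its [N^2] points have
    probability [N^-2] each; anything outside is negligible. *)
Lemma prob_sum_box (E : set T) : measurable E ->
  P E = (\sum_(z <- box N) P (E `&` Z @^-1` [set z]))%E.
Proof.
move=> mE; pose G := \bigcup_(z in [set` box N]) Z @^-1` [set z].
have fbox : finite_set [set` box N] by exact: finite_seq.
have triv F : trivIset [set` box N] (fun z => F `&` Z @^-1` [set z]).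
  by move=> z z' _ _ [t [[_ <-] [_ <-]]].
have mG : measurable G.
  by apply: fin_bigcup_measurable => // z _; exact: measurable_pair.
have PG : P G = 1%E.
  rewrite /G -[X in P X]setTI setI_bigcupr measure_fin_bigcup//; last first.
    by move=> z _; apply: measurableI => //; exact: measurable_pair.
  rewrite -fsbig_seq ?box_uniq// big_seq (eq_bigr (fun=> (N%:R ^- 2)%:E)).
    rewrite -big_seq sumEFin sumr_const_seq.
    by rewrite size_box natrX divff// gt_eqF// exprn_gt0// ltr0n.
  by move=> z zN; rewrite setTI/= prob_pair zN.
have PGC : P (~` G) = 0%E by rewrite probability_setC// PG subee.
have EG0 : P (E `\` G) = 0%E.
  apply: (subset_measure0 _ _ _ PGC) => //; first exact: measurableD.
    exact: measurableC.
rewrite (measureDI P mE mG) [X in (X + _)%E]EG0 add0e /G setI_bigcupr measure_fin_bigcup//.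
  by rewrite -fsbig_seq ?box_uniq.
by move=> z _; apply: measurableI => //; exact: measurable_pair.
Qed.

Lemma prob_pair_prod (w : nat) (z : nat * nat) :
  P (W @^-1` [set w] `&` Z @^-1` [set z]) =
  (if (z \in box N) && ((z.1 * z.2)%N == w) then N%:R ^- 2 else 0)%:E.
Proof.
have [zw|zw] := eqVneq (z.1 * z.2)%N w.
  rewrite andbT -prob_pair; congr (P _); apply/seteqP; split => t /=; first by case.
  by move=> Zt; split => //; rewrite -zw -Zt.
rewrite andbF (_ : _ `&` _ = set0) ?measure0//.
by apply/seteqP; split => t //= [Wt Zt]; move: zw; rewrite -Zt/= -Wt eqxx.
Qed.

Lemma prob_prod (w : nat) :
  P (W @^-1` [set w]) = ((rep N w)%:R * N%:R ^- 2)%:E.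
Proof.
rewrite (prob_sum_box _ (measurable_prod w)).
under eq_bigr do rewrite prob_pair_prod.
rewrite sumEFin; congr (_%:E).
rewrite /rep -sum1_count natr_sum mulr_suml [RHS]big_mkcond/=.
rewrite big_seq [RHS]big_seq; apply: eq_bigr => z ->.
by rewrite mul1r.
Qed.

(** Given [X * Y = w], the pair is uniform on the [rep N w] factorizations of [w],
    so its conditional entropy is [log2 (rep N w)]; weighting by the probability
    [rep N w / N^2] turns the sum over [w] into a sum over the box. *)
Lemma cond_entropy_prod :
  cond_entropy P Z W =
  ((\sum_(z <- box N) ln (rep N (z.1 * z.2))%:R) / (N%:R ^+ 2 * ln 2))%:E.
Proof.
have N2 : (0 : R) < N%:R ^+ 2 by rewrite exprn_gt0// ltr0n.
have l2 : 0 < ln 2 :> R by rewrite ln_gt0// ltr1n.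
have term w : (P (W @^-1` [set w]) *
    pmf_entropy (fun z => cond_prob P (Z @^-1` [set z]) (W @^-1` [set w])) =
    ((rep N w)%:R * (N%:R ^- 2 * log2 (rep N w)%:R))%:E)%E.
  rewrite prob_prod; have [->|r0] := posnP (rep N w).
    by rewrite !mul0r mul0e.
  rewrite (pmf_entropy_uniform _ [seq z <- box N | (z.1 * z.2)%N == w]).
  - by rewrite size_filter -/(rep N w) -EFinM mulrA.
  - by rewrite filter_uniq// box_uniq.
  - by rewrite size_filter.
  move=> z; rewrite /cond_prob setIC prob_pair_prod prob_prod/= mem_filter andbC.
  rewrite size_filter -/(rep N w); case: ifP => _; last by rewrite mul0r.
  by field; rewrite !gt_eqF// ltr0n.
rewrite /cond_entropy; under eq_esum do rewrite term.
rewrite (esum_seq _ (index_iota 1 (N ^ 2).+1)) ?iota_uniq//.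
- rewrite sumEFin -(sum_box_fiber _ (fun w => N%:R ^- 2 * log2 (rep N w)%:R)).
  rewrite mulr_suml; congr (_%:E); apply: eq_bigr => z _.
  by rewrite /log2; field; rewrite !gt_eqF ?ltr0n ?N0.
- move=> w; rewrite lee_fin; have [->|r0] := posnP (rep N w); first by rewrite mul0r.
  by rewrite !mulr_ge0 ?invr_ge0 ?(ltW N2) ?(ltW l2)// ln_ge0// ler1n.
- move=> w; rewrite mem_index_iota => wN.
  suff -> : rep N w = 0%N by rewrite mul0r.
  apply/eqP; rewrite -leqn0 leqNgt -has_count; apply/negP => /hasP[[a b]].
  rewrite mem_box/= => /andP[/andP[a0 aN] /andP[b0 bN]] /eqP wE.
  by move: wN; rewrite -wE muln_gt0 a0 b0 ltnS -mulnn leq_mul.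
Qed.
End product.
End entropy.

Theorem mainTheorem1 (R : realType) :
  exists (c C : R) (N0 : nat), 0 < c /\ c <= C /\
    forall (N : nat), (1 <= N)%N -> (N0 <= N)%N ->
    forall (d : measure_display) (T : measurableType d) (P : probability T R)
           (X Y : {RV P >-> nat}),
      uniform_1_to N X -> uniform_1_to N Y -> indep_RV X Y ->
      ((c * log2 (log2 N%:R))%:E
         <= cond_entropy P (fun t => (X t, Y t)) (fun t => (X t * Y t)%N))%E /\
      (cond_entropy P (fun t => (X t, Y t)) (fun t => (X t * Y t)%N)
         <= (C * log2 (log2 N%:R))%:E)%E.
Proof.
have h := @ln2_gt_half R; have h1 := @ln2_le1 R.
pose K : R := 8 / (ln 2 - 1 / 2).
exists (ln 2 - 1 / 2), 4, (Num.truncn (expR (expR K))).+1.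
split; [lra|split; [lra|]] => N N1 NK d T P X Y uX uY iXY.
have NR : expR (expR K) <= N%:R.
  by rewrite (le_trans (ltW (truncnS_gt _)))// ler_nat.
have /andP[lo hi] := mean_ln_rep_bounds N N1 NR.
have D0 : 0 < N%:R ^+ 2 * ln 2 :> R by rewrite mulr_gt0 ?exprn_gt0 ?ltr0n//; lra.
have logE (k : R) : k * log2 (log2 N%:R) =
    N%:R ^+ 2 * (k * ln (ln N%:R / ln 2)) / (N%:R ^+ 2 * ln 2).
  rewrite /log2 -[RHS]mulf_div divff ?mul1r ?mulrA// gt_eqF// exprn_gt0// ltr0n//.
rewrite (cond_entropy_prod P N X Y N1 uX uY iXY) !lee_fin !logE.
by rewrite !ler_pM2r ?invr_gt0.
Qed.
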